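(* Let $m,n,a$ be positive integers with $m\ge 6$. The number of standard Young tableaux of battery shape $[(m^n),a,6]$ is equal to $f^{(m^n)}\cdot{}_{[3,5,7,9,11]}F_{[2,4,6,8,10]}$ evaluated with all arguments $z_i=1$ and with the following parameters, where $t,v,w,r$ denote the first four summation indices: upper parameters: row 0: $a,\ m,\ -n$; row 1: $a+t,\ m-1,\ -n-1,\ -t,\ -t$; row 2: $a+t+v,\ m-2,\ -n-2,\ -t-1,\ -t-1,\ -v,\ -v$; row 3: $a+t+v+w,\ m-3,\ -n-3,\ -t-2,\ -t-2,\ -v-1,\ -v-1,\ -w,\ -w$; row 4: $a+t+v+w+r,\ m-4,\ -n-4,\ -t-3,\ -t-3,\ -v-2,\ -v-2,\ -w-1,\ -w-1,\ -r,\ -r$; lower parameters: row 0: $-mn,\ 1$; row 1: $-mn+t,\ -t-1,\ -t-1,\ 1$; row 2: $-mn+t+v,\ -t-2,\ -t-2,\ -v-1,\ -v-1,\ 1$; row 3: $-mn+t+v+w,\ -t-3,\ -t-3,\ -v-2,\ -v-2,\ -w-1,\ -w-1,\ 1$; row 4: $-mn+t+v+w+r,\ -t-4,\ -t-4,\ -v-3,\ -v-3,\ -w-2,\ -w-2,\ -r-1,\ -r-1,\ 1$. That is, it is equal to $$f^{(m^n)}\sum_{t=0}^{n}\sum_{v=0}^{t}\sum_{w=0}^{v}\sum_{r=0}^{w}\sum_{k=0}^{r} A_t\,B_{t,v}\,C_{t,v,w}\,D_{t,v,w,r}\,E_{t,v,w,r,k},$$ where $$A_t=\frac{(a)_t(m)_t(-n)_t}{(-mn)_t(1)_t\,t!},\qquad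 B_{t,v}=\frac{(a+t)_v(m-1)_v(-n-1)_v(-t)_v^2}{(-mn+t)_v(-t-1)_v^2(1)_v\,v!},$$ $$C_{t,v,w}=\frac{(a+t+v)_w(m-2)_w(-n-2)_w(-t-1)_w^2(-v)_w^2}{(-mn+t+v)_w(-t-2)_w^2(-v-1)_w^2(1)_w\,w!},$$ $$D_{t,v,w,r}=\frac{(a+t+v+w)_r(m-3)_r(-n-3)_r(-t-2)_r^2(-v-1)_r^2(-w)_r^2}{(-mn+t+v+w)_r(-t-3)_r^2(-v-2)_r^2(-w-1)_r^2(1)_r\,r!},$$ $$E_{t,v,w,r,k}=\frac{(a+t+v+w+r)_k(m-4)_k(-n-4)_k(-t-3)_k^2(-v-2)_k^2(-w-1)_k^2(-r)_k^2}{(-mn+t+v+w+r)_k(-t-4)_k^2(-v-3)_k^2(-w-2)_k^2(-r-1)_k^2(1)_k\,k!}.$$ Here $f^{(m^n)}$ is the number of standard Young tableaux of rectangular shape $(m^n)$.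
   Context: $(m^n)$ denotes the partition with $n$ parts all equal to $m$ (Young diagram with $n$ rows and $m$ columns; row 1 is the top row). For integers $a\ge 1$, $1\le q\le m$, the battery shape $[(m^n),a,q]$ (of size $mn+a$) is obtained from the Young diagram of $(m^n)$ by adding a column of $a$ cells directly above the top cell of the $q$-th column; in coordinates it consists of the cells $(i,j)$ with $1\le i\le n$, $1\le j\le m$, together with the cells $(0,q),(-1,q),\dots,(1-a,q)$, where the first coordinate is the row (increasing downwards) and the second the column. A standard Young tableau of a shape with $M$ cells is a bijection from the set of cells to $\{1,\dots,M\}$ such that entries increase from left to right in each row and from top to bottom in each column (including the added cells). Pochhammer symbol: $(x)_0=1$, $(x)_s=x(x+1)\cdots(x+s-1)$ for $s\ge1$. Multiple hypergeometric function: for rows $i=0,\dots,N$ with upper parameters $a_{i,1},\dots,a_{i,x_i}$, lower parameters $b_{i,1},\dots,b_{i,y_i}$ and arguments $z_i$, where $a_{i,j},b_{i,j}$ may depend on the summation indices $m_l$ with $l<i$, $${}_{[x_0,\dots,x_N]}F_{[y_0,\dots,y_N]}[\cdots]=\sum_{m_0\ge 0}\ \sum_{m_1=0}^{m_0}\cdots\sum_{m_N=0}^{m_{N-1}}\ \prod_{i=0}^{N}\frac{\prod_{j=1}^{x_i}(a_{i,j})_{m_i}}{\prod_{j=1}^{y_i}(b_{i,j})_{m_i}}\frac{z_i^{m_i}}{m_i!}.$$ When row $0$ contains an upper parameter $-p$ and a lower parameter $-s$ with integers $0\le p\le s$, the sum over $m_0$ is truncated to $0\le m_0\le p$. In the claim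 the indices $m_0,m_1,m_2,m_3,m_4$ are called $t,v,w,r,k$. *)

(* Defs.v *)
From HB Require Import structures.
From mathcomp Require Import all_boot all_order all_algebra finmap.
Set Implicit Arguments.
Unset Strict Implicit.
Unset Printing Implicit Defensive.
Import Order.TTheory GRing.Theory Num.Theory.
Local Open Scope ring_scope.

(* A cell is a pair (row, column); rows increase downwards and may be <= 0. *)
Definition cell : Type := (int * int)%type.

Definition rect_shape (m n : nat) : {fset cell} :=
  [fset c in [seq (i%:Z, j%:Z) | i <- iota 1 n, j <- iota 1 m]]%fset.

Definition battery_shape (m n a q : nat) : {fset cell} :=
  (rect_shape m n `|` [fset c in [seq (- l%:Z, q%:Z) | l <- iota 0 a]])%fset.

(* T c : 'I_M encodes the entry (T c).+1 of {1, ..., M}, with M = #|` D|. *)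
Definition is_syt (D : {fset cell}) (T : {ffun D -> 'I_(#|` D|)}) : bool :=
  [&& injectiveb T,
      [forall k, k \in codom T],
      [forall c : D, forall d : D,
         ((val c).1 == (val d).1) && ((val c).2 < (val d).2) ==>
         (T c < T d)%N]
    & [forall c : D, forall d : D,
         ((val c).2 == (val d).2) && ((val c).1 < (val d).1) ==>
         (T c < T d)%N]].

Definition num_syt (D : {fset cell}) : nat :=
  #|[set T : {ffun D -> 'I_(#|` D|)} | is_syt T]|.

Definition poch (x : rat) (s : nat) : rat := \prod_(0 <= i < s) (x + i%:R).

(* One row of a multiple hypergeometric function; the parameters of row i are
   functions of the list [:: m_0; ...; m_(i-1)] of the preceding indices. *)
Record hyp_row := HypRow {
  hyp_upper : seq nat -> seq rat;
  hyp_lower : seq nat -> seq rat;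
  hyp_arg : rat
}.

Definition hyp_term (R : hyp_row) (ms : seq nat) (s : nat) : rat :=
  (\prod_(x <- hyp_upper R ms) poch x s) / (\prod_(y <- hyp_lower R ms) poch y s)
  * (hyp_arg R ^+ s / (s`!)%:R).

Fixpoint mhyp_from (rows : seq hyp_row) (ms : seq nat) (p : nat) : rat :=
  if rows is R :: rows' then
    \sum_(0 <= s < p.+1) hyp_term R ms s * mhyp_from rows' (rcons ms s) s
  else 1.

(* The series whose outermost sum is truncated to 0 <= m_0 <= p, as is the
   convention when row 0 has an upper parameter -p and a lower parameter -s
   with 0 <= p <= s. *)
Definition mhyp (p : nat) (rows : seq hyp_row) : rat := mhyp_from rows [::] p.

Definition battery6_rows (m n a : nat) : seq hyp_row :=
  let A : rat := a%:R in
  let M : rat := m%:R in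
  let N : rat := n%:R in
  let idx (ms : seq nat) (i : nat) : rat := (nth 0%N ms i)%:R in
  [:: HypRow
        (fun _ => [:: A; M; - N])
        (fun _ => [:: - (M * N); 1])
        1;
      HypRow
        (fun ms => let t := idx ms 0%N in
           [:: A + t; M - 1; - N - 1; - t; - t])
        (fun ms => let t := idx ms 0%N in
           [:: - (M * N) + t; - t - 1; - t - 1; 1])
        1;
      HypRow
        (fun ms => let t := idx ms 0%N in let v := idx ms 1%N in
           [:: A + t + v; M - 2; - N - 2; - t - 1; - t - 1; - v; - v])
        (fun ms => let t := idx ms 0%N in let v := idx ms 1%N in
           [:: - (M * N) + t + v; - t - 2; - t - 2; - v - 1; - v - 1; 1])
        1;
      HypRow
        (fun ms => let t := idx ms 0%N in let v := idx ms 1%N in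
                   let w := idx ms 2%N in
           [:: A + t + v + w; M - 3; - N - 3; - t - 2; - t - 2;
               - v - 1; - v - 1; - w; - w])
        (fun ms => let t := idx ms 0%N in let v := idx ms 1%N in
                   let w := idx ms 2%N in
           [:: - (M * N) + t + v + w; - t - 3; - t - 3;
               - v - 2; - v - 2; - w - 1; - w - 1; 1])
        1;
      HypRow
        (fun ms => let t := idx ms 0%N in let v := idx ms 1%N in
                   let w := idx ms 2%N in let r := idx ms 3%N in
           [:: A + t + v + w + r; M - 4; - N - 4; - t - 3; - t - 3;
               - v - 2; - v - 2; - w - 1; - w - 1; - r; - r])
        (fun ms => let t := idx ms 0%N in let v := idx ms 1%N in
                   let w := idx ms 2%N in let r := idx ms 3%N in
           [:: - (M * N) + t + v + w + r; - t - 4; - t - 4;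
               - v - 3; - v - 3; - w - 2; - w - 2; - r - 1; - r - 1; 1])
        1].

(* Main.v *)
Require Import Defs.
From mathcomp Require Import all_boot all_order all_algebra finmap.
From mathcomp Require Import zify ring.
Set Implicit Arguments.
Unset Strict Implicit.
Unset Printing Implicit Defensive.
Import Order.TTheory GRing.Theory Num.Theory.
Local Open Scope ring_scope.

(** Let q = 6 and k = 5, and cut a standard filling of the battery at the moment
when the last cell of the added column, the one resting on column q, receives
its entry.  The cells of the rectangle filled by then form a partition with
column lengths c_0 >= ... >= c_4, all at most n: column q and the columns to
its right are still empty, because the cell (1, q) lies below the added
column.  The filling therefore amounts to
 - a standard filling of that partition, of size s, shuffled with the a - 1
   upper cells of the added column: f^c * binomial (s + a - 1, s) choices;
 - a standard filling of the rest of the rectangle: f^(m^n / c) choices.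
The fivefold hypergeometric sum is the sum over c of these products: its
summation indices t, v, w, r, k are the five column lengths, and its summand is
the product divided by f^(m^n).

Every count is handled through one recursion ([num_syt_rec]): the entry 1 sits
in a minimal cell, and deleting that cell leaves a standard tableau.  For a
rectangle with a partition removed, this recursion is solved by the
hook-length formula in Frobenius' form N! * Delta(x) / prod x_j!, where the
x_j are the beta-numbers of the rest and Delta is the Vandermonde product; the
identity which makes it a solution is [vdm_frobenius].  Illegal moves need no
separate treatment: they make two beta-numbers equal, so that Delta = 0, or
they lower a beta-number 0, whose coefficient in the identity is 0.

The cut itself is done by weights instead of bijections ([chimney_transfer]).
The explicit number [interleavings k c b] of standard fillings of c together
with b cells of the added column satisfies the recursion which removes the
last filled cell; the number of ways to complete such a state satisfies the
one which fills the next cell.  Exchanging the two summations shows that the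
weighted total of the completions does not depend on b.

It remains to divide the two Frobenius products ([interleavings_weight]) and
to recognise the quotient as the product of the hypergeometric rows
([battery6_weight]): row j collects the factors c_i - c_j + j - i for i < j,
which come from the pairs of Pochhammer symbols through
(-x)_c / (-x-1)_c = (x+1-c) / (x+1). *)

(** * The Vandermonde product and Frobenius' identity *)

Definition vdm (k : nat) (x : nat -> rat) : rat :=
  \prod_(j < k) \prod_(i < j) (x j - x i).

Definition fall_poly (i : nat) : {poly rat} :=
  \prod_(0 <= s < i) ('X - s%:R%:P).

Lemma fall_poly_horner i x : (fall_poly i).[x] = \prod_(s < i) (x - s%:R).
Proof.
rewrite /fall_poly big_mkord horner_prod.
by apply: eq_bigr => s _; rewrite hornerXsubC.
Qed.

(** The falling factorials p_i(x) = x(x-1)...(x-i+1) are monic of degree i, so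
they differ from the powers of x by a unitriangular change of basis. *)
Lemma vdm_det k (x : nat -> rat) :
  vdm k x = \det (\matrix_(i < k, j < k) (fall_poly i).[x j]).
Proof.
pose V := Vandermonde k (\row_(j < k) x j).
pose S := \matrix_(i < k, l < k) (fall_poly i)`_l.
have size_f i : size (fall_poly i) = i.+1 by rewrite size_prod_XsubC size_iota subn0.
have -> : \matrix_(i < k, j < k) (fall_poly i).[x j] = S *m V.
  apply/matrixP => i j; rewrite !mxE (@horner_coef_wide _ k) ?size_f //.
  by apply: eq_bigr => l _; rewrite !mxE.
have trigS : is_trig_mx S.
  by apply/is_trig_mxP => i l lt_il; rewrite mxE nth_default // size_f.
rewrite det_mulmx (det_trig trigS) det_Vandermonde big1 ?mul1r; last first.
  move=> i _; rewrite mxE; have := monic_prod_XsubC (index_iota 0 i) predT (fun s => s%:R : rat).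
  by rewrite monicE lead_coefE -/(fall_poly i) size_f => /eqP.
rewrite /vdm (exchange_big_dep predT) //=; apply: eq_bigr => j _.
rewrite (big_ord_widen k (fun i => x j - x i)) 1?ltnW //.
by apply: eq_bigr => i _; rewrite !mxE.
Qed.

Definition lower_at (x : nat -> rat) (j : nat) : nat -> rat :=
  fun i => x i - (i == j)%:R.

(** By [vdm_det], lowering x_j by one replaces the entries p_i(x_j) of one
column by p_i(x_j - 1), and x * p_i(x - 1) = (x - i) * p_i(x).  In the Leibniz
expansion the sum over j thus multiplies the term of a permutation by the sum
of x_j - i over its entries (i, j), which is the same for every permutation. *)
Lemma vdm_frobenius k (x : nat -> rat) :
  \sum_(j < k) x j * vdm k (lower_at x j)
    = (\sum_(j < k) x j - 'C(k, 2)%:R) * vdm k x.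
Proof.
rewrite vdm_det /determinant mulr_sumr.
under eq_bigr do rewrite vdm_det /determinant mulr_sumr.
rewrite exchange_big; apply: eq_bigr => s _.
rewrite -bin2_sum big_mkord natr_sum.
rewrite (reindex_inj (@perm.perm_inj _ s)) [X in (X - _) * _](reindex_inj (@perm.perm_inj _ s)) /=.
rewrite -sumrB mulr_suml; apply: eq_bigr => j _.
rewrite mulrCA [RHS]mulrCA; congr (_ * _).
rewrite (bigD1 j) //= [in RHS](bigD1 j) //= !mxE !mulrA.
congr (_ * _); last first.
  apply: eq_bigr => i ne_ij; rewrite !mxE /lower_at.
  by rewrite (inj_eq val_inj) (inj_eq perm.perm_inj) (negbTE ne_ij) subr0.
rewrite /lower_at eqxx !fall_poly_horner; move: (x _) => z.
(* Both sides are the next falling factorial. *)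
transitivity (\prod_(s < j.+1) (z - s%:R)).
  rewrite big_ord_recl subr0; congr (_ * _).
  by apply: eq_bigr => s' _; rewrite -addrA -opprD -mulrS.
by rewrite big_ord_recr mulrC.
Qed.

Definition decr_at (x : nat -> nat) (j : nat) : nat -> nat :=
  fun i => (x i - (i == j))%N.

(** For the increasing beta-numbers x of a partition this is f / N!, where f is
its number of standard tableaux and N its size; for decreasing ones the sign
is that of the reversal of k letters. *)
Definition hook_ratio (k : nat) (x : nat -> nat) : rat :=
  vdm k (fun j => (x j)%:R) / (\prod_(j < k) (x j)`!)%:R.

Lemma eq_vdm k x y : (forall i, (i < k)%N -> x i = y i) -> vdm k x = vdm k y.
Proof.
move=> exy; apply: eq_bigr => j _; apply: eq_bigr => i _.
by rewrite !exy // (ltn_trans (ltn_ord i)).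
Qed.

Lemma eq_hook_ratio k x y :
  (forall i, (i < k)%N -> x i = y i) -> hook_ratio k x = hook_ratio k y.
Proof.
move=> exy; rewrite /hook_ratio; congr (_ / _%:R).
  by apply: eq_vdm => i ltik; rewrite exy.
by apply: eq_bigr => i _; rewrite exy.
Qed.

(** Dividing by the factorials turns the coefficient x_j into the step from
x_j! to (x_j - 1)!. *)
Lemma hook_ratio_frobenius k (x : nat -> nat) :
  \sum_(j < k | (0 < x j)%N) hook_ratio k (decr_at x j)
    = ((\sum_(j < k) x j)%N%:R - 'C(k, 2)%:R) * hook_ratio k x.
Proof.
rewrite /hook_ratio mulrA natr_sum -vdm_frobenius mulr_suml big_mkcond /=.
apply: eq_bigr => j _; case: posnP => [-> | xj_gt0]; first by rewrite !mul0r.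
rewrite (@eq_vdm _ _ (lower_at (fun i => (x i)%:R) j)); last first.
  by move=> i _; rewrite /decr_at /lower_at natrB //; case: eqP => // ->.
rewrite (bigD1 j) //= [in RHS](bigD1 j) //= /decr_at eqxx subn1.
rewrite (eq_bigr (fun i : 'I_k => (x i)`!)); last first.
  by move=> i /negbTE ne_ij; rewrite (inj_eq val_inj) ne_ij subn0.
rewrite -[in RHS](prednK xj_gt0) factS prednK // !natrM.
have: (x j)%:R != 0 :> rat by rewrite pnatr_eq0 -lt0n.
have: ((x j).-1)`!%:R != 0 :> rat by rewrite pnatr_eq0 -lt0n fact_gt0.
have: (\prod_(i < k | i != j) (x i)`!)%:R != 0 :> rat.
  by rewrite pnatr_eq0 -lt0n prodn_gt0 // => i; rewrite fact_gt0.
by move=> *; field; apply/and3P.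
Qed.

Lemma vdm_eq0 k (x : nat -> rat) i j :
  (i < j < k)%N -> x i = x j -> vdm k x = 0.
Proof.
case/andP=> lt_ij lt_jk eq_x; rewrite /vdm (bigD1 (Ordinal lt_jk)) //=.
by rewrite (bigD1 (Ordinal lt_ij)) //= eq_x subrr !mul0r.
Qed.

Lemma vdm_neq0 k (x : nat -> nat) :
  (forall i j, (i < j < k)%N -> x i <> x j) -> vdm k (fun j => (x j)%:R) != 0.
Proof.
move=> neq; apply/prodf_neq0 => j _; apply/prodf_neq0 => i _.
rewrite subr_eq0 eqr_nat eq_sym; apply/eqP/neq; by rewrite !ltn_ord.
Qed.

Lemma hook_ratio_neq0 k (x : nat -> nat) :
  (forall i j, (i < j < k)%N -> x i <> x j) -> hook_ratio k x != 0.
Proof.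
move=> neq; rewrite mulf_neq0 ?vdm_neq0 // invr_eq0 pnatr_eq0 -lt0n.
by apply: prodn_gt0 => i; rewrite fact_gt0.
Qed.

(** * Removing the cell that carries the smallest entry *)

Definition before (c d : cell) : bool :=
  (c.1 == d.1) && (c.2 < d.2) || (c.2 == d.2) && (c.1 < d.1).

Definition minimal_cell (D : {fset cell}) (c : cell) : bool :=
  all (fun d => ~~ before d c) (enum_fset D).

Lemma is_sytP (D : {fset cell}) (T : {ffun D -> 'I_(#|` D|)}) :
  reflect (injective T /\
           forall c d : D, before (val c) (val d) -> (T c < T d)%N)
          (is_syt T).
Proof.
apply: (iffP and4P) => [[/injectiveP injT _ /forallP rowT /forallP colT] | [injT ltT]].
  split=> // c d /orP[]; move: c d.
    by move=> c d; move: (rowT c) => /forallP/(_ d)/implyP.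
  by move=> c d; move: (colT c) => /forallP/(_ d)/implyP.
split; first exact/injectiveP.
- apply/forallP => k; apply: inj_card_onto => //.
  by rewrite card_ord cardfE.
- apply/'forall_forallP => c d; apply/implyP => lt_cd.
  by apply: ltT; rewrite /before lt_cd.
- apply/'forall_forallP => c d; apply/implyP => lt_cd.
  by apply: ltT; rewrite /before lt_cd orbT.
Qed.

Lemma syt_onto (D : {fset cell}) (T : {ffun D -> 'I_(#|` D|)}) k :
  is_syt T -> exists c, T c = k.
Proof. by case/and4P=> _ /forallP/(_ k)/codomP[c ->] _ _; exists c. Qed.

Lemma before_irrefl c : before c c = false.
Proof. by rewrite /before !ltxx !andbF. Qed.

(** Fix a cell c of D and let K be D without c.  Standard tableaux of D with
smallest entry at c correspond to those of K by raising all entries by one and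
putting the smallest entry at c; this is a tableau of D exactly when c is
minimal. *)
Section RemoveFirst.

Variables (D : {fset cell}) (c : D).
Let K : {fset cell} := (D `\ val c)%fset.

Let cardK : (#|` K|).+1 = #|` D|.
Proof. by rewrite [RHS](cardfsD1 (val c)) (valP c). Qed.

Let inD (d : K) : val d \in D.
Proof. by have := valP d; rewrite in_fsetD1 => /andP[]. Qed.

Let neqc (d : K) : val d != val c.
Proof. by have := valP d; rewrite in_fsetD1 => /andP[]. Qed.

Let lift_cell (d : K) : D := FSetSub (inD d).

Definition prepend (T : {ffun K -> 'I_(#|` K|)}) : {ffun D -> 'I_(#|` D|)} :=
  [ffun d : D => cast_ord cardK
     (if insub (val d) is Some d' then lift ord0 (T d') else ord0)].

Let prepend_c T : prepend T c = 0%N :> nat.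
Proof. by rewrite ffunE insubF //= in_fsetD1 eqxx. Qed.

Let prepend_lift T (d : K) : prepend T (lift_cell d) = (T d).+1 :> nat.
Proof. by rewrite ffunE /= valK. Qed.

Let cell_cases (d : D) : d = c \/ exists d', d = lift_cell d'.
Proof.
case: (eqVneq d c) => [|ne_dc]; [by left | right].
have dK : val d \in K by rewrite in_fsetD1 (inj_eq val_inj) ne_dc (valP d).
by exists (FSetSub dK); apply: val_inj.
Qed.

Lemma prepend_inj : injective prepend.
Proof.
move=> T T' eqT; apply/ffunP => d; apply: ord_inj; apply: succn_inj.
by rewrite -!prepend_lift eqT.
Qed.

Lemma prepend_syt T :
  minimal_cell D (val c) -> is_syt (prepend T) = is_syt T.
Proof.
move=> /allP minc; apply/is_sytP/is_sytP => -[injT ltT]; split.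
- move=> d e eqT; suff [/val_inj] : lift_cell d = lift_cell e by [].
  by apply: injT; apply: ord_inj; rewrite !prepend_lift eqT.
- move=> d e lt_de; rewrite -ltnS -!prepend_lift.
  exact: (ltT (lift_cell d) (lift_cell e)).
- move=> d e; have [->|[d' ->]] := cell_cases d;
    have [->|[e' ->]] := cell_cases e => // /(congr1 (@nat_of_ord _));
    rewrite ?prepend_c ?prepend_lift //=.
  by case=> /ord_inj/injT->.
- move=> d e; have [->|[d' ->]] := cell_cases d;
    have [->|[e' ->]] := cell_cases e; rewrite ?prepend_c ?prepend_lift //=.
  + by rewrite before_irrefl.
  + by move=> lt_dc; have := minc _ (inD d'); rewrite lt_dc.
  + by move=> lt_de; rewrite ltnS; apply: ltT.
Qed.

Lemma prepend_onto (T : {ffun D -> 'I_(#|` D|)}) :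
  is_syt T -> T c = 0%N :> nat -> exists T', T = prepend T'.
Proof.
case/is_sytP=> injT _ Tc.
have lt_pred (d : K) : ((T (lift_cell d)).-1 < #|` K|)%N.
  have := leq_trans (ltn_ord (T (lift_cell d))) (eq_leq (esym cardK)).
  rewrite ltnS.
  have K_gt0 : (0 < #|` K|)%N by rewrite cardfs_gt0; apply/fset0Pn; exists (val d); apply: valP.
  by case: (nat_of_ord _).
exists [ffun d => Ordinal (lt_pred d)]; apply/ffunP => d; apply: ord_inj.
have [->|[d' ->]] := cell_cases d; first by rewrite prepend_c.
rewrite prepend_lift ffunE /= prednK // lt0n; apply/eqP => Td'.
have /(congr1 val)/= : lift_cell d' = c by apply: injT; apply: ord_inj; rewrite Td'.
by apply/eqP; apply: neqc.
Qed.

Lemma card_syt_first : minimal_cell D (val c) ->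
  #|[set T : {ffun D -> 'I_(#|` D|)} | is_syt T && (T c == 0%N :> nat)]|
    = num_syt K.
Proof.
move=> minc; rewrite /num_syt -[RHS](card_imset _ prepend_inj).
apply: eq_card => T; rewrite inE; apply/andP/imsetP => [[sytT /eqP Tc] | [T' sytT' ->]].
  have [T' eqT] := prepend_onto sytT Tc; exists T' => //.
  by rewrite inE -(prepend_syt _ minc) -eqT.
by rewrite prepend_syt // prepend_c eqxx; rewrite inE in sytT'.
Qed.

Lemma card_syt_not_first : ~~ minimal_cell D (val c) ->
  #|[set T : {ffun D -> 'I_(#|` D|)} | is_syt T && (T c == 0%N :> nat)]| = 0%N.
Proof.
case/allPn=> d Dd /negbNE lt_dc; apply/eqP; rewrite cards_eq0; apply/eqP/setP => T.
rewrite !inE; apply/negP=> /andP[/is_sytP[_ ltT] /eqP Tc].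
by have := ltT (FSetSub Dd) c lt_dc; rewrite Tc.
Qed.

End RemoveFirst.

(** The smallest entry of a standard tableau lies in a unique cell, and this
cell is minimal. *)
Lemma num_syt_rec (D : {fset cell}) : D != fset0 ->
  num_syt D = (\sum_(c <- enum_fset D | minimal_cell D c) num_syt (D `\ c)%fset)%N.
Proof.
move=> Dn0; have D_gt0 : (0 < #|` D|)%N by rewrite cardfs_gt0.
rewrite big_seq_fsetE /= big_mkcond /=.
transitivity (\sum_(c : D)
    #|[set T : {ffun D -> 'I_(#|` D|)} | is_syt T && (T c == 0%N :> nat)]|)%N.
  under eq_bigr do rewrite -sum1dep_card.
  rewrite (exchange_big_dep (@is_syt D)) /=; last by move=> c T _ /andP[].
  rewrite /num_syt -sum1dep_card; apply: eq_bigr => T sytT.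
  have [c Tc] := syt_onto (Ordinal D_gt0) sytT.
  rewrite (big_pred1 c) // => d; rewrite sytT /=.
  have [injT _] := is_sytP _ sytT.
  apply/eqP/eqP => [Td | ->]; last by rewrite Tc.
  by apply: injT; apply: ord_inj; rewrite Td Tc.
apply: eq_bigr => c _; case: ifPn; first exact: card_syt_first.
exact: card_syt_not_first.
Qed.

Lemma num_syt0 : num_syt fset0 = 1%N.
Proof.
apply/eqP/cards1P.
have no_cell (c : (fset0 : {fset cell})) : False by have := valP c; rewrite in_fset0.
pose T0 : {ffun (fset0 : {fset cell}) -> 'I_(#|` (fset0 : {fset cell})|)} :=
  [ffun c => False_rect _ (no_cell c)].
exists T0; apply/setP => T; rewrite !inE.
have -> : T = T0 by apply/ffunP => c; case: (no_cell c).
by rewrite eqxx; apply/is_sytP; split=> c; case: (no_cell c).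
Qed.

(** * Rectangles with a partition removed, with and without a chimney *)

(** Columns and rows are counted from 0 here, so h j is the length of the part
removed from the top of column j. *)
Definition skew (m n : nat) (h : nat -> nat) : {fset cell} :=
  [fset c in [seq (i.+1%:Z, j.+1%:Z) | j <- iota 0 m, i <- iota (h j) (n - h j)]]%fset.

Definition chimney (e q : nat) : {fset cell} :=
  [fset c in [seq (- l%:Z, q%:Z) | l <- iota 0 e]]%fset.

Definition incr_at (h : nat -> nat) (j : nat) : nat -> nat :=
  fun i => (h i + (i == j))%N.

Definition addable (n : nat) (h : nat -> nat) (j : nat) : bool :=
  (h j < n)%N && ((j == 0)%N || (h j < h j.-1)%N).

Definition nonincr (h : nat -> nat) : Prop := forall i j, (i <= j)%N -> (h j <= h i)%N.

Lemma skewP m n h c :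
  reflect (exists i j, c = (i.+1%:Z, j.+1%:Z) /\ [&& j < m, h j <= i & i < n]%N)
          (c \in skew m n h).
Proof.
rewrite in_fset; apply: (iffP allpairsPdep) => [[j [i [Hj Hi ->]]] | [i [j [-> H]]]].
  by exists i, j; split=> //; move: Hj Hi; rewrite !mem_iota; lia.
by exists j, i; rewrite !mem_iota; split=> //; lia.
Qed.

Lemma mem_skew m n h i j :
  ((i.+1%:Z, j.+1%:Z) \in skew m n h) = [&& j < m, h j <= i & i < n]%N.
Proof.
apply/skewP/idP => [[i' [j' [[<- <-]]]] // | H]; by exists i, j.
Qed.

Lemma chimneyP e q c :
  reflect (exists2 l, c = (- l%:Z, q%:Z) & (l < e)%N) (c \in chimney e q).
Proof.
rewrite in_fset; apply: (iffP mapP) => [[l Hl ->] | [l -> Hl]].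
  by exists l => //; move: Hl; rewrite mem_iota.
by exists l => //; rewrite mem_iota.
Qed.

Lemma minimal_cellP (D : {fset cell}) c :
  reflect (forall d, d \in D -> ~~ before d c) (minimal_cell D c).
Proof. exact: allP. Qed.

(** A cell that is not the top of its column, or whose left neighbour is
present, has an earlier cell next to it; any other earlier cell would
contradict the monotonicity of h. *)
Lemma minimal_skew m n h i j : nonincr h -> (j < m)%N -> (h j <= i < n)%N ->
  minimal_cell (skew m n h) (i.+1%:Z, j.+1%:Z)
    = (i == h j) && ((j == 0)%N || (h j < h j.-1)%N).
Proof.
move=> nih lt_jm Hi; apply/minimal_cellP/andP => [minc | [/eqP-> Hj] d].
  have Hij : i = h j.
    apply/eqP; rewrite eqn_leq; apply/andP; split; last by case/andP: Hi.
    rewrite leqNgt; apply/negP => lt_hi; case: i => // i in Hi minc lt_hi *.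
    have := minc (i.+1%:Z, j.+1%:Z); rewrite mem_skew /before /=.
    by move/(_ ltac:(lia)); lia.
  rewrite Hij eqxx; split=> //; case: j => //= j in lt_jm Hi minc Hij *.
  rewrite ltnNge; apply/negP => le_hh.
  have := minc (i.+1%:Z, j.+1%:Z); rewrite mem_skew /before /=.
  by move/(_ ltac:(lia)); lia.
case/skewP => i' [j' [-> H]]; rewrite /before /=; apply/negP => Hb.
have [lt_j | [ej ei]] : ((j' < j) /\ (i' = h j) \/ j' = j /\ (i' < h j))%N by lia.
  by have := nih j' j.-1 ltac:(lia); lia.
by rewrite ej in H; lia.
Qed.

Definition corner (h : nat -> nat) (j : nat) : cell := ((h j).+1%:Z, j.+1%:Z).

Lemma skew_rem m n h j : (j < m)%N ->
  (skew m n h `\ corner h j)%fset = skew m n (incr_at h j).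
Proof.
move=> lt_jm; apply/fsetP => c; rewrite in_fsetD1.
apply/andP/skewP => [[ne_c /skewP[i [j' [ec H]]]] | [i [j' [-> H]]]].
  exists i, j'; split=> //; rewrite /incr_at; case: eqP => [ej | _]; last by lia.
  suff : i != h j by rewrite ej in H *; lia.
  by apply: contraNneq ne_c => eqi; rewrite ec ej eqi.
rewrite /corner mem_skew; move: H; rewrite /incr_at; case: (eqVneq j' j) => [->|nej] H.
  by split; first (apply/eqP; case; lia); lia.
by split; first (apply/eqP; case => _ /eqP; rewrite (negbTE nej)); lia.
Qed.

Lemma corner_inj h : injective (corner h).
Proof. by move=> i j [_ ->]. Qed.

Lemma minimal_cells_skew m n h : nonincr h ->
  perm_eq [seq c <- enum_fset (skew m n h) | minimal_cell (skew m n h) c]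
          [seq corner h j | j <- iota 0 m & addable n h j].
Proof.
move=> nih; apply: uniq_perm.
- exact/filter_uniq/fset_uniq.
- rewrite map_inj_uniq ?filter_uniq ?iota_uniq //; exact: corner_inj.
move=> c; rewrite mem_filter; apply/andP/mapP => [[minc /skewP[i [j [ec H]]]] | [j]].
  move: minc; rewrite ec minimal_skew //; try lia; case/andP=> /eqP ei Hj.
  by exists j; rewrite /corner -?ei // mem_filter mem_iota /addable; lia.
rewrite mem_filter mem_iota => /andP[/andP[lt_hn Hj] lt_jm] ->.
split; last by rewrite mem_skew; lia.
by rewrite minimal_skew ?eqxx //; lia.
Qed.

Lemma sum_iota k (P : pred nat) (F : nat -> nat) :
  (\sum_(j <- iota 0 k | P j) F j = \sum_(j < k | P j) F j)%N.
Proof. by rewrite -(big_mkord P F) /index_iota subn0. Qed.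

Lemma num_skew_rec m n h : nonincr h -> skew m n h != fset0 ->
  num_syt (skew m n h)
    = (\sum_(j < m | addable n h j) num_syt (skew m n (incr_at h j)))%N.
Proof.
move=> nih Dn0; rewrite num_syt_rec // -big_filter.
rewrite (perm_big _ (minimal_cells_skew m n nih)) big_map big_filter sum_iota.
by apply: eq_bigr => j _; rewrite skew_rem.
Qed.

Definition chimney_on (m n : nat) (h : nat -> nat) (e k : nat) : {fset cell} :=
  (skew m n h `|` chimney e k.+1)%fset.

(** Column k is complete and carries the chimney, so its top rectangle cell is
not minimal; the columns to its right are complete as well and start with a
cell that has a left neighbour. *)
Lemma minimal_cells_chimney m n h e k : nonincr h -> (k < m)%N -> h k = 0%N ->
  perm_eq [seq c <- enum_fset (chimney_on m n h e.+1 k)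
             | minimal_cell (chimney_on m n h e.+1 k) c]
          ((- e%:Z, k.+1%:Z) :: [seq corner h j | j <- iota 0 k & addable n h j]).
Proof.
move=> nih lt_km hk0; apply: uniq_perm.
- exact/filter_uniq/fset_uniq.
- rewrite /= map_inj_uniq ?filter_uniq ?iota_uniq ?andbT //; last exact: corner_inj.
  by apply/mapP => -[j _ []]; lia.
move=> c; rewrite mem_filter in_cons in_fsetU; apply/andP/orP => [[/minimal_cellP minc] | ].
  have minS d : d \in skew m n h -> ~~ before d c.
    by move=> Hd; apply: minc; rewrite in_fsetU Hd.
  have minC l : (l <= e)%N -> ~~ before (- l%:Z, k.+1%:Z) c.
    move=> Hl; apply: minc; rewrite in_fsetU; apply/orP; right.
    by apply/chimneyP; exists l.
  case/orP => [/skewP[i [j [ec H]]] | /chimneyP[l ec lt_le]].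
    right; move/minimal_cellP: minS; rewrite ec minimal_skew //; try lia.
    case/andP=> /eqP ei Hj; have lt_jk : (j < k)%N.
      rewrite ltnNge; apply/negP => le_kj.
      have [ej | lt_kj] : (j = k \/ k < j)%N by lia.
        by have := minC 0%N isT; rewrite ec /before /=; lia.
      by have := nih k j.-1 ltac:(lia); lia.
    apply/mapP; exists j; rewrite /corner -?ei // mem_filter mem_iota /addable.
    by lia.
  left; have := minC e (leqnn e); rewrite ec /before /= => He.
  by apply/eqP; congr (_, _); lia.
case=> [/eqP-> | /mapP[j]].
  split; last by apply/orP; right; apply/chimneyP; exists e.
  apply/minimal_cellP => d; rewrite in_fsetU => /orP[].
    by case/skewP=> i [j [-> _]]; rewrite /before /=; lia.
  by case/chimneyP=> l -> lt_le; rewrite /before /=; lia.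
rewrite mem_filter mem_iota => /andP[/andP[lt_hn Hj] lt_jk] ->.
split; last by rewrite mem_skew; lia.
apply/minimal_cellP => d; rewrite in_fsetU => /orP[].
  apply/minimal_cellP; rewrite minimal_skew ?eqxx //; lia.
by case/chimneyP=> l -> _; rewrite /before /corner /=; lia.
Qed.

Lemma num_chimney_rec m n h e k : nonincr h -> (k < m)%N -> h k = 0%N ->
  num_syt (chimney_on m n h e.+1 k)
    = (num_syt (chimney_on m n h e k)
       + \sum_(j < k | addable n h j)
            num_syt (chimney_on m n (incr_at h j) e.+1 k))%N.
Proof.
move=> nih lt_km hk0.
have top_in : (- e%:Z, k.+1%:Z) \in chimney e.+1 k.+1 by apply/chimneyP; exists e.
rewrite num_syt_rec; last first.
  by apply/fset0Pn; exists (- e%:Z, k.+1%:Z); rewrite in_fsetU top_in orbT.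
rewrite -big_filter (perm_big _ (minimal_cells_chimney n e nih lt_km hk0)).
rewrite big_cons big_map big_filter sum_iota.
congr (_ + _)%N.
  congr num_syt; apply/fsetP => c; rewrite in_fsetD1 !in_fsetU.
  apply/andP/orP => [[ne_c /orP[?|/chimneyP[l ec Hl]]]|[/skewP[i [j [-> H]]]|/chimneyP[l -> Hl]]].
  - by left.
  - right; apply/chimneyP; exists l => //.
    suff : l != e by lia.
    by apply: contraNneq ne_c => <-; rewrite ec.
  - by split; [apply/eqP; case; lia | rewrite mem_skew H].
  split; first by apply/eqP; case; lia.
  by apply/orP; right; apply/chimneyP; exists l => //; lia.
apply: eq_bigr => j _; congr num_syt; rewrite /chimney_on -skew_rem; last by have := ltn_ord j; lia.
rewrite fsetDUl; congr (_ `|` _)%fset; apply/fsetDidPl.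
by apply/fdisjointP => c /chimneyP[l -> _]; rewrite in_fset1 /corner; apply/eqP; case; lia.
Qed.

(** * Frobenius' formula for skew and straight shapes *)

Lemma eq_skew m n h h' : (forall j, (j < m)%N -> h j = h' j) ->
  skew m n h = skew m n h'.
Proof.
move=> eqh; apply/fsetP => c; apply/skewP/skewP => -[i [j [-> H]]];
  by exists i, j; split=> //; move: H; case: ltnP => //= /eqh ->.
Qed.

Lemma nonincr_incr n h j : nonincr h -> addable n h j -> nonincr (incr_at h j).
Proof.
move=> nih /andP[_ Hj] i i' le_ii'; rewrite /incr_at.
case: (eqVneq i' j) => [e' | _]; last by have := nih _ _ le_ii'; lia.
rewrite e' in le_ii' *; case: (eqVneq i j) => [-> // | ne_ij].
by have := nih i j.-1 ltac:(lia); lia.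
Qed.

(** The beta-numbers, in increasing order, of the partition obtained by turning
the remaining part of the rectangle upside down. *)
Definition skew_beta (n : nat) (h : nat -> nat) (j : nat) : nat := (n - h j + j)%N.

Definition skew_size (m n : nat) (h : nat -> nat) : nat := (\sum_(j < m) (n - h j))%N.

Lemma sum_ord_id k : (\sum_(j < k) j = 'C(k, 2))%N.
Proof. by rewrite -bin2_sum big_mkord. Qed.

(** Removing the next cell of column j lowers the j-th beta-number.  If column
j is not addable, the lowered number would be negative or meets its left
neighbour, and the corresponding term of Frobenius' identity vanishes. *)
Lemma hook_ratio_skew_rec m n h : nonincr h -> (forall j, h j <= n)%N ->
  \sum_(j < m | addable n h j) hook_ratio m (skew_beta n (incr_at h j))
    = (skew_size m n h)%:R * hook_ratio m (skew_beta n h).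
Proof.
move=> nih le_hn.
have -> : (skew_size m n h)%:R = (\sum_(j < m) skew_beta n h j)%N%:R - 'C(m, 2)%:R :> rat.
  by rewrite big_split /= sum_ord_id natrD addrK.
rewrite -hook_ratio_frobenius [LHS]big_mkcond [RHS]big_mkcond; apply: eq_bigr => j _.
have := le_hn j; rewrite /addable /skew_beta; case: ifP => Hadd le_j.
  have -> : (0 < n - h j + j)%N by lia.
  apply: eq_hook_ratio => i _; rewrite /incr_at /decr_at; case: eqP => [-> | _]; lia.
case: ifP => // Hpos.
have Hj : (0 < j)%N by lia.
have eqh : h j = h j.-1 by have := nih j.-1 j (leq_pred j); have := le_hn j.-1; lia.
have -> : hook_ratio m (decr_at (fun i => n - h i + i)%N j) = 0; last by [].
rewrite /hook_ratio (@vdm_eq0 _ _ j.-1 j) ?mul0r //; first by have := ltn_ord j; lia.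
by rewrite /decr_at eqxx eqh; congr _%:R; case: eqP; lia.
Qed.

(** The factor at the identity is the value of the formula at the empty shape:
both sides solve the same recursion and are compared where it starts. *)
Lemma num_syt_skew m n h : nonincr h -> (forall j, h j <= n)%N ->
  (num_syt (skew m n h))%:R * hook_ratio m id
    = (skew_size m n h)`!%:R * hook_ratio m (skew_beta n h).
Proof.
move eqN: (skew_size m n h) => N nih le_hn.
elim: N => [|N IH] in h nih le_hn eqN *.
  have h_full j : (j < m)%N -> h j = n.
    move=> lt_jm; move/eqP: eqN; rewrite sum_nat_eq0 => /forallP/(_ (Ordinal lt_jm)) /=.
    by have := le_hn j; lia.
  have -> : skew m n h = fset0.
    apply/fsetP => c; rewrite in_fset0; apply/skewP => -[i [j [_ H]]].
    by have := h_full j; lia.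
  rewrite num_syt0 !mul1r; apply: eq_hook_ratio => j lt_jm.
  by rewrite /skew_beta h_full // subnn.
have size_incr (j : 'I_m) : addable n h j -> skew_size m n (incr_at h j) = N.
  case/andP=> lt_hn _; move: eqN; rewrite /skew_size (bigD1 j) //= [in X in _ -> X](bigD1 j) //=.
  rewrite [X in _ -> (_ + X)%N = _](eq_bigr (fun i : 'I_m => n - h i)%N); last first.
    by move=> i /negbTE ne_ij; rewrite /incr_at (inj_eq val_inj) ne_ij addn0.
  by rewrite /incr_at eqxx; lia.
rewrite num_skew_rec //; last first.
  apply/negP => /eqP D0; suff : skew_size m n h = 0%N by rewrite eqN.
  apply: big1 => j _; apply/eqP; rewrite subn_eq0 leqNgt; apply/negP => lt_hn.
  have : corner h j \in skew m n h by rewrite mem_skew ltn_ord leqnn lt_hn.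
  by rewrite D0.
rewrite natr_sum mulr_suml.
rewrite (eq_bigr (fun j : 'I_m => N`!%:R * hook_ratio m (skew_beta n (incr_at h j)))); last first.
  move=> j Hj; apply: IH; last exact: size_incr.
    exact: nonincr_incr Hj.
  by move=> i; case/andP: Hj => lt_hn _; have := le_hn i; rewrite /incr_at; case: eqP => [->|_]; lia.
rewrite -mulr_sumr hook_ratio_skew_rec // eqN factS natrM; ring.
Qed.

(** Column j can be shortened; for the last column this is meaningful because h
vanishes beyond it. *)
Definition removable (h : nat -> nat) (j : nat) : bool := (h j.+1 < h j)%N.

(** The beta-numbers, in decreasing order, of the partition h with k columns. *)
Definition straight_beta (k : nat) (h : nat -> nat) (j : nat) : nat := (h j + (k.-1 - j))%N.

Lemma sum_ord_rev k : (\sum_(j < k) (k.-1 - j) = 'C(k, 2))%N.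
Proof.
rewrite -sum_ord_id [RHS](reindex_inj rev_ord_inj) /=; apply: eq_bigr => j _.
by have := ltn_ord j; lia.
Qed.

(** The counterpart of [hook_ratio_skew_rec] for shrinking partitions: a column that
is not removable has beta-number 0, if it is the last one, or would lower it to
that of its right neighbour. *)
Lemma hook_ratio_straight_rec k h : nonincr h -> h k = 0%N ->
  \sum_(j < k | removable h j) hook_ratio k (straight_beta k (decr_at h j))
    = (\sum_(j < k) h j)%N%:R * hook_ratio k (straight_beta k h).
Proof.
move=> nih hk0.
have -> : (\sum_(j < k) h j)%N%:R = (\sum_(j < k) straight_beta k h j)%N%:R - 'C(k, 2)%:R :> rat.
  by rewrite big_split /= sum_ord_rev natrD addrK.
rewrite -hook_ratio_frobenius [LHS]big_mkcond [RHS]big_mkcond; apply: eq_bigr => j _.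
rewrite /removable /straight_beta; case: ifP => Hrem.
  have -> : (0 < h j + (k.-1 - j))%N by lia.
  apply: eq_hook_ratio => i _; rewrite /decr_at; case: eqP => [-> | _]; lia.
case: ifP => // Hpos; have lt_jk := ltn_ord j.
have eqh : h j.+1 = h j by have := nih j j.+1 (leqnSn j); lia.
have lt_Sjk : (j.+1 < k)%N.
  rewrite ltnNge; apply/negP => le_k; have ek : k = j.+1 by lia.
  by rewrite -ek hk0 in eqh; lia.
have -> : hook_ratio k (decr_at (fun i => h i + (k.-1 - i))%N j) = 0; last by [].
rewrite /hook_ratio (@vdm_eq0 _ _ j j.+1) ?mul0r //; first by lia.
by rewrite /decr_at eqxx eqh; congr _%:R; case: eqP; lia.
Qed.

(** * Cutting along the chimney *)

(** The recursion follows the nesting of the sums of a multiple hypergeometric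
series, where every index is bounded by the preceding one. *)
Fixpoint parts (k p : nat) : seq (seq nat) :=
  if k is k'.+1 then [seq s :: l | s <- iota 0 p.+1, l <- parts k' s]
  else [:: [::]].

Lemma nonincr_cons s l :
  nonincr (nth 0%N (s :: l)) <-> nonincr (nth 0%N l) /\ (nth 0%N l 0 <= s)%N.
Proof.
split=> [nisl | H].
  by split=> [i j le_ij | ]; [exact: (nisl i.+1 j.+1) | exact: (nisl 0%N 1%N)].
move: H => [ni le_s] [|i] [|j] //= le_ij; last exact: ni.
exact: leq_trans (ni 0%N j (leq0n j)) le_s.
Qed.

Lemma partsP k p l :
  reflect [/\ size l = k, nonincr (nth 0%N l) & (nth 0%N l 0 <= p)%N]
          (l \in parts k p).
Proof.
elim: k p l => [|k IH] p l.
  rewrite inE; apply: (iffP eqP) => [->|[/size0nil]//].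
  by split=> // i j _; rewrite !nth_nil.
apply: (iffP allpairsPdep) => [[s [l' [Hs /IH[sz ni le_s] ->]]] | [sz ni le_p]].
  split=> /=; [by rewrite sz | exact/nonincr_cons | by move: Hs; rewrite (mem_iota 0 p.+1)].
case: l => //= s l in sz ni le_p *; move/nonincr_cons: ni => [ni le_s].
exists s, l; split=> //; first by rewrite (mem_iota 0 p.+1).
by apply/IH; split=> //; case: sz.
Qed.

Lemma parts_uniq k p : uniq (parts k p).
Proof.
elim: k p => [|k IH] p; first by [].
apply: (allpairs_uniq_dep (iota_uniq 0 p.+1)).
  by move=> s _; apply: IH.
by move=> [s l] [s' l'] _ _ /= [-> ->].
Qed.

(** The two ways to describe an edge of Young's lattice that changes column j:
by its lower end or by its upper end. *)
Lemma parts_incr k n j :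
  (j < k)%N ->
  perm_eq [seq incr_nth l j | l <- parts k n & addable n (nth 0%N l) j]
          [seq l <- parts k n | removable (nth 0%N l) j].
Proof.
move=> lt_jk.
have nth_incr l : nth 0%N (incr_nth l j) =1 incr_at (nth 0%N l) j.
  by move=> i; rewrite nth_incr_nth /incr_at addnC eq_sym.
have sz l : l \in parts k n -> (j < size l)%N by case/partsP => ->.
apply: uniq_perm.
- rewrite map_inj_in_uniq ?filter_uniq ?parts_uniq // => l l'.
  rewrite !mem_filter => /andP[_ /partsP[szl _ _]] /andP[_ /partsP[szl' _ _]] eql.
  apply: (@eq_from_nth _ 0%N) => [|i _]; first by rewrite szl szl'.
  by have := congr1 (nth 0%N ^~ i) eql; rewrite !nth_incr_nth => /addnI.
- by rewrite filter_uniq ?parts_uniq.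
move=> l; apply/mapP/idP => [[l0] | ]; rewrite mem_filter.
  case/andP=> Hadd Hl0 ->; have [szl ni le_n] := partsP _ _ _ Hl0.
  rewrite mem_filter; apply/andP; split.
    rewrite /removable !nth_incr /incr_at eqxx; have := ni j j.+1 (leqnSn j).
    by case: eqP; lia.
  apply/partsP; rewrite size_incr_nth sz //; split=> //.
    have ni' := nonincr_incr ni Hadd; move=> i i' le_ii'.
    by rewrite !nth_incr; apply: ni'.
  by rewrite nth_incr /incr_at; case/andP: Hadd => + _; case: eqP => [<-|_]; lia.
case/andP=> Hrem Hl; have [szl ni le_n] := partsP _ _ _ Hl.
pose l0 := set_nth 0%N l j (nth 0%N l j).-1.
have nth0 i : nth 0%N l0 i = decr_at (nth 0%N l) j i.
  by rewrite nth_set_nth /= /decr_at; case: eqP => [->|_]; lia.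
have szl0 : size l0 = k by rewrite size_set_nth szl; lia.
move: Hrem; rewrite /removable => Hrem; exists l0; last first.
  apply: (@eq_from_nth _ 0%N) => [|i _]; first by rewrite size_incr_nth szl0 lt_jk.
  by rewrite nth_incr /incr_at nth0 /decr_at; case: eqP => [->|_]; lia.
rewrite mem_filter; apply/andP; split.
  rewrite /addable !nth0 /decr_at eqxx; have := ni 0%N j (leq0n j).
  case: (posnP j) => [j0 | j_gt0]; first by rewrite j0 in Hrem *; lia.
  by have := ni j.-1 j (leq_pred j); case: eqP; lia.
apply/partsP; split=> // [i i' le_ii'|]; last first.
  by rewrite nth0 /decr_at; lia.
rewrite !nth0 /decr_at; case: (eqVneq i j) => [ei|_]; last by have := ni _ _ le_ii'; lia.
rewrite ei in le_ii' *; case: (eqVneq i' j) => [-> // | ne].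
by have := ni j.+1 i' ltac:(lia); lia.
Qed.

(** The number of standard fillings of the partition h shuffled with a chain of
b cells: (s + b)! / (s! b!) times Frobenius' value of f^h for size s.  The last
quotient is normalised to be 1 at the empty partition. *)
Definition interleavings (k : nat) (h : nat -> nat) (b : nat) : rat :=
  ((\sum_(j < k) h j)%N + b)`!%:R / b`!%:R
  * (hook_ratio k (straight_beta k h) / hook_ratio k (straight_beta k (fun=> 0%N))).

Lemma eq_interleavings k h h' b : (forall j, (j < k)%N -> h j = h' j) ->
  interleavings k h b = interleavings k h' b.
Proof.
move=> eqh; rewrite /interleavings (eq_bigr (fun j : 'I_k => h' j)) => [|j _]; last exact: eqh.
congr (_ * (_ / _)); apply: eq_hook_ratio => i lt_ik; by rewrite /straight_beta eqh.
Qed.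

Lemma hook_ratio_straight0_neq0 k : hook_ratio k (straight_beta k (fun=> 0%N)) != 0.
Proof. by apply: hook_ratio_neq0 => i j; rewrite /straight_beta; lia. Qed.

(** Classification by the last cell: it belongs to the partition in a proportion
s / (s + b) of the fillings and to the chain in the others.  The summand for
b = 0 is the empty filling, which has no last cell. *)
Lemma interleavings_rec k h b : nonincr h -> h k = 0%N ->
  interleavings k h b =
    \sum_(j < k | removable h j) interleavings k (decr_at h j) b
    + (if b is b'.+1 then interleavings k h b' else (\sum_(j < k) h j == 0)%N%:R).
Proof.
move=> nih hk0; set s := (\sum_(j < k) h j)%N.
have sum_dec (j : 'I_k) : removable h j -> (\sum_(i < k) decr_at h j i)%N = s.-1.
  move=> Hj; rewrite /s (bigD1 j) //= [in RHS](bigD1 j) //=.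
  rewrite (eq_bigr (fun i : 'I_k => h i)); last first.
    by move=> i /negbTE ne_ij; rewrite /decr_at (inj_eq val_inj) ne_ij subn0.
  by rewrite /decr_at eqxx; move: Hj; rewrite /removable; lia.
pose F := hook_ratio k (straight_beta k h); pose F0 := hook_ratio k (straight_beta k (fun=> 0%N)).
have -> : \sum_(j < k | removable h j) interleavings k (decr_at h j) b
            = (s.-1 + b)`!%:R / b`!%:R * (s%:R * F / F0).
  rewrite /s /F -hook_ratio_straight_rec // mulrA mulr_sumr mulr_suml -/s.
  by apply: eq_bigr => j Hj; rewrite /interleavings sum_dec // mulrA.
have b_neq0 (c : nat) : c`!%:R != 0 :> rat by rewrite pnatr_eq0 -lt0n fact_gt0.
have F0_neq0 : F0 != 0 := hook_ratio_straight0_neq0 k.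
have c_neq0 (c : nat) : c.+1%:R != 0 :> rat by rewrite pnatr_eq0.
rewrite /interleavings -/s -/F -/F0; case: (posnP s) => [s0 | s_gt0].
  have -> : F = F0.
    apply: eq_hook_ratio => i lt_ik; rewrite /straight_beta; congr (_ + _)%N.
    by move/eqP: s0; rewrite sum_nat_eq0 => /forallP/(_ (Ordinal lt_ik))/eqP.
  rewrite s0 !add0n mul0r mul0r mulr0 add0r.
  by case: b => [|b]; rewrite ?eqxx !divff // mulr1.
rewrite -(prednK s_gt0) /= addSn factS natrM; set s' := s.-1.
case: b => [|b]; rewrite ?addr0.
  by rewrite addn0; field; rewrite ?b_neq0 ?F0_neq0.
rewrite addSn !addnS !factS !natrM.
have -> : (s' + b).+2%:R = s'.+1%:R + b.+1%:R :> rat by rewrite -natrD addnS.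
move: b.+1%:R (c_neq0 b) s'.+1%:R => u u_neq0 v.
by field; rewrite F0_neq0 b_neq0 u_neq0.
Qed.

(** [parts_incr] as a change of the summation index.  As f reads its argument
pointwise, lowering column j of the upper end restores the lower end. *)
Lemma sum_addable k n j (f : (nat -> nat) -> rat) (g : seq nat -> rat) :
  (j < k)%N -> (forall h h', (forall i, (i < k)%N -> h i = h' i) -> f h = f h') ->
  \sum_(l <- parts k n | addable n (nth 0%N l) j) f (nth 0%N l) * g (incr_nth l j)
    = \sum_(l <- parts k n | removable (nth 0%N l) j) f (decr_at (nth 0%N l) j) * g l.
Proof.
move=> lt_jk eq_f; rewrite -[RHS]big_filter -(perm_big _ (parts_incr n lt_jk)) big_map.
rewrite big_filter; apply: eq_bigr => l _; congr (_ * _); apply: eq_f => i _.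
by rewrite /decr_at nth_incr_nth eq_sym addKn.
Qed.

(** At each stage b the left-hand side counts the fillings of the whole shape by
the partition that is filled when the (b+1)-st chimney cell is placed.  Step b
to b+1 expresses the completions by [num_chimney_rec], moves the sum over
addable columns to removable ones with [sum_addable], and then applies
[interleavings_rec]; only the chimney term survives. *)
Lemma chimney_transfer k m n a b : (k < m)%N -> (b < a)%N ->
  \sum_(l <- parts k n)
     interleavings k (nth 0%N l) b * (num_syt (chimney_on m n (nth 0%N l) (a - b.+1) k))%:R
  = (num_syt (chimney_on m n (fun=> 0%N) a k))%:R.
Proof.
move=> lt_km.
pose H (l : seq nat) e : rat := (num_syt (chimney_on m n (nth 0%N l) e k))%:R.
have step c : (c < a)%N ->
    \sum_(l <- parts k n) interleavings k (nth 0%N l) c * H l (a - c.+1)%N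
    = \sum_(l <- parts k n)
        (if c is c'.+1 then interleavings k (nth 0%N l) c' else (\sum_(j < k) nth 0%N l j == 0)%N%:R)
        * H l (a - c)%N.
  move=> lt_ca; set e := (a - c.+1)%N; have -> : (a - c = e.+1)%N by rewrite /e; lia.
  have recH l : l \in parts k n ->
      H l e = H l e.+1 - \sum_(j < k | addable n (nth 0%N l) j) H (incr_nth l j) e.+1.
    case/partsP=> szl ni _; rewrite /H num_chimney_rec //; last by rewrite nth_default ?szl.
    rewrite natrD natr_sum; apply/eqP; rewrite eq_sym subr_eq; apply/eqP.
    congr (_ + _); apply: eq_bigr => j _; congr (num_syt _)%:R; rewrite /chimney_on.
    congr (_ `|` _)%fset; apply: eq_skew => i _.
    by rewrite nth_incr_nth /incr_at addnC eq_sym.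
  have recP l : l \in parts k n ->
     (if c is c'.+1 then interleavings k (nth 0%N l) c' else (\sum_(j < k) nth 0%N l j == 0)%N%:R)
     = interleavings k (nth 0%N l) c - \sum_(j < k | removable (nth 0%N l) j) interleavings k (decr_at (nth 0%N l) j) c.
    case/partsP=> szl ni _; rewrite [X in _ = X - _]interleavings_rec //; last by rewrite nth_default ?szl.
    by rewrite addrC addKr.
  rewrite [LHS]big_seq [RHS]big_seq.
  under eq_bigr => l Hl do rewrite recH // mulrBr mulr_sumr.
  under [RHS]eq_bigr => l Hl do rewrite recP // mulrBl mulr_suml.
  rewrite -!big_seq !sumrB; congr (_ - _).
  rewrite (exchange_big_dep predT) //= [RHS](exchange_big_dep predT) //=.
  apply: eq_bigr => j _.
  apply: (@sum_addable k n j (fun h => interleavings k h c) (fun l => H l e.+1)) => // h h'.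
  exact: eq_interleavings.
elim: b => [|b IH] lt_ba; last by rewrite step // IH // ltnW.
rewrite step // subn0.
have zero_in : nseq k 0%N \in parts k n.
  by apply/partsP; rewrite size_nseq; split=> // [i j _|]; rewrite !nth_nseq !if_same.
rewrite (bigD1_seq (nseq k 0%N)) ?parts_uniq //= [X in _ + X]big_seq_cond [X in _ + X]big1 ?addr0.
  rewrite big1 ?eqxx ?mul1r => [|j _]; last by rewrite nth_nseq if_same.
  rewrite /H /chimney_on; congr (num_syt (_ `|` _)%fset)%:R.
  by apply: eq_skew => j _; rewrite nth_nseq if_same.
move=> l /andP[/partsP[szl _ _] ne_l]; case: eqP => [/eqP|_]; last by rewrite mul0r.
rewrite sum_nat_eq0 => /forallP Hl; case/eqP: ne_l.
apply: (@eq_from_nth _ 0%N) => [|i lt_i]; first by rewrite size_nseq.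
by rewrite szl in lt_i; rewrite nth_nseq if_same; apply/eqP/(Hl (Ordinal lt_i)).
Qed.

(** * The summand as a quotient of Frobenius products *)

Lemma natr_fact_neq0 c : c`!%:R != 0 :> rat.
Proof. by rewrite pnatr_eq0 -lt0n fact_gt0. Qed.

Lemma pochD x s t : poch x (s + t) = poch x s * poch (x + s%:R) t.
Proof.
rewrite /poch !big_mkord big_split_ord /=; congr (_ * _).
by apply: eq_bigr => i _; rewrite natrD addrA.
Qed.

Lemma poch_once x : poch x 1 = x.
Proof. by rewrite /poch big_nat1 addr0. Qed.

Lemma poch_fact b c : (b + c)`!%:R = b`!%:R * poch b.+1%:R c.
Proof.
elim: c => [|c IH]; first by rewrite addn0 /poch big_geq // mulr1.
rewrite addnS factS natrM IH /poch big_nat_recr //= -natrD addSn.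
by rewrite mulrC -mulrA.
Qed.

Lemma poch1 c : poch 1 c = c`!%:R.
Proof. by have := poch_fact 0 c; rewrite mul1r add0n => ->. Qed.

Lemma poch_opp N c : (c <= N)%N -> N`!%:R = (-1) ^+ c * poch (- N%:R) c * (N - c)`!%:R.
Proof.
elim: c => [|c IH] lt_cN; first by rewrite subn0 /poch big_geq // !mul1r.
rewrite IH 1?ltnW // /poch big_nat_recr //= exprS.
have -> : (N - c)`!%:R = (N%:R - c%:R) * (N - c.+1)`!%:R :> rat.
  by rewrite -natrB 1?ltnW // -natrM -subnSK // factS.
ring.
Qed.

Lemma poch_opp_neq0 N c : (c <= N)%N -> poch (- N%:R) c != 0.
Proof.
move=> /poch_opp eqN; have := natr_fact_neq0 N; rewrite eqN.
by apply: contraNneq => ->; rewrite mulr0 mul0r.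
Qed.

Lemma poch_nat_neq0 b c : (0 < b)%N -> poch b%:R c != 0.
Proof.
case: b => // b _; have := natr_fact_neq0 (b + c); rewrite poch_fact.
by apply: contraNneq => ->; rewrite mulr0.
Qed.

Lemma poch_opp_ratio x c : (c <= x)%N ->
  poch (- x%:R) c / poch (- x%:R - 1) c = (x.+1%:R - c%:R) / x.+1%:R.
Proof.
move=> le_cx; have x1_neq0 : x.+1%:R != 0 :> rat by rewrite pnatr_eq0.
have ex : - x%:R - 1 = - x.+1%:R :> rat by rewrite -addn1 natrD opprD.
rewrite ex; apply/eqP; rewrite eqr_div //; last by rewrite poch_opp_neq0 // leqW.
apply/eqP; have := pochD (- x.+1%:R) 1 c; have := pochD (- x.+1%:R) c 1.
rewrite addn1 add1n => ->.
rewrite !poch_once => /eqP; rewrite -ex subrK => /eqP; rewrite ex => eqp.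
have -> : poch (- x%:R) c * x.+1%:R = - (- x.+1%:R * poch (- x%:R) c) by ring.
by rewrite -eqp; ring.
Qed.

(** Weyl's dimension formula for the representation of GL_k with highest weight
c; both families of beta-numbers have this normalised Vandermonde product. *)
Definition weyl_dim (k : nat) (c : nat -> nat) : rat :=
  \prod_(j < k) \prod_(i < j)
    (((c i)%:R - (c j)%:R + (j%:R - i%:R)) / (j%:R - i%:R)).

Lemma vdm_ratio k (x y : nat -> rat) c :
  (forall i j, (i < j < k)%N ->
     (x j - x i) / (y j - y i) =
       ((c i)%:R - (c j)%:R + (j%:R - i%:R)) / (j%:R - i%:R)) ->
  vdm k x / vdm k y = weyl_dim k c.
Proof.
move=> eq_ratio; rewrite /vdm -prodf_div; apply: eq_bigr => j _.
by rewrite -prodf_div; apply: eq_bigr => i _; rewrite eq_ratio // !ltn_ord.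
Qed.

Lemma hook_ratio_quot k (x y : nat -> nat) :
  hook_ratio k x / hook_ratio k y
    = vdm k (fun j => (x j)%:R) / vdm k (fun j => (y j)%:R)
      * \prod_(j < k) ((y j)`!%:R / (x j)`!%:R).
Proof.
by rewrite /hook_ratio prodf_div -!natr_prod invfM invrK; ring.
Qed.

Lemma hook_ratio_straight k c :
  hook_ratio k (straight_beta k c) / hook_ratio k (straight_beta k (fun=> 0%N))
    = weyl_dim k c / \prod_(i < k) poch (k - i)%N%:R (c i).
Proof.
rewrite hook_ratio_quot (@vdm_ratio _ _ _ c); last first.
  move=> i j /andP[lt_ij lt_jk]; rewrite /straight_beta !natrD !natrB; try lia.
  by rewrite -[LHS]mulrNN -invrN; congr (_ / _); ring.
congr (_ * _); rewrite -prodfV; apply: eq_bigr => i _; rewrite /straight_beta add0n.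
have lt_ik := ltn_ord i; rewrite addnC poch_fact; have -> : (k.-1 - i).+1 = (k - i)%N by lia.
by rewrite invfM mulrA divff ?natr_fact_neq0 // mul1r.
Qed.

Lemma prod_sign k (c : nat -> nat) (f : nat -> rat) :
  \prod_(i < k) ((-1) ^+ c i * f i) = (-1) ^+ (\sum_(i < k) c i) * \prod_(i < k) f i.
Proof. by rewrite big_split /= prodrXr. Qed.

Lemma hook_ratio_skew k n c : (forall j, c j <= n)%N ->
  hook_ratio k (skew_beta n c) / hook_ratio k (skew_beta n (fun=> 0%N))
    = weyl_dim k c
      * ((-1) ^+ (\sum_(i < k) c i) * \prod_(i < k) poch (- (n%:R + i%:R)) (c i)).
Proof.
move=> le_cn; rewrite hook_ratio_quot (@vdm_ratio _ _ _ c); last first.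
  move=> i j /andP[lt_ij lt_jk]; rewrite /skew_beta !natrD !natrB //.
  by congr (_ / _); ring.
rewrite -(prod_sign k c (fun i => poch (- (n%:R + i%:R)) (c i))); congr (_ * _).
apply: eq_bigr => i _; rewrite /skew_beta subn0 -natrD.
have le_cni : (c i <= n + i)%N by have := le_cn i; lia.
rewrite (poch_opp le_cni) -addnBAC // mulfK ?natr_fact_neq0 //.
Qed.

(** Beyond column k the beta-numbers do not depend on c.  The factors that link
a column i < k with all the later ones telescope to a Pochhammer quotient. *)
Lemma hook_ratio_skew_extend k p n c :
  (forall j, c j <= n)%N -> (forall j, k <= j -> c j = 0)%N ->
  hook_ratio (k + p) (skew_beta n c) / hook_ratio (k + p) (skew_beta n (fun=> 0%N))
    = hook_ratio k (skew_beta n c) / hook_ratio k (skew_beta n (fun=> 0%N))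
      * \prod_(i < k) (poch (k + p - i)%N%:R (c i) / poch (k - i)%N%:R (c i)).
Proof.
move=> le_cn c0.
have skew_beta_tail q : skew_beta n c (k + q) = skew_beta n (fun=> 0%N) (k + q).
  by rewrite /skew_beta c0 ?leq_addr.
have vdm_split x : vdm (k + p) x = vdm k x *
    ((\prod_(q < p) \prod_(i < k) (x (k + q)%N - x i)) *
     (\prod_(q < p) \prod_(i < q) (x (k + q)%N - x (k + i)%N))).
  rewrite /vdm big_split_ord; congr (_ * _); rewrite -big_split /=.
  by apply: eq_bigr => q _; rewrite big_split_ord.
rewrite !hook_ratio_quot !vdm_split big_split_ord /=.
rewrite [X in _ * (_ * X) = _]big1 ?mulr1; last first.
  by move=> q _; rewrite skew_beta_tail divff ?natr_fact_neq0.
set T := \prod_(q < p) \prod_(i < q) _; set T' := \prod_(q < p) \prod_(i < q) _.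
have eqT : T' = T.
  apply: eq_bigr => q _; apply: eq_bigr => i _; by rewrite !skew_beta_tail.
have T_neq0 : T != 0.
  rewrite -eqT; apply/prodf_neq0 => q _; apply/prodf_neq0 => i _.
  by rewrite subr_eq0 eqr_nat /skew_beta; have := ltn_ord i; lia.
rewrite eqT -!mulf_div divff // mulr1 mulrAC; congr (_ * _).
rewrite (exchange_big_dep predT) //= [X in _ / X](exchange_big_dep predT) //=.
rewrite -prodf_div; apply: eq_bigr => i _; have lt_ik := ltn_ord i.
have prod_poch (h : nat -> nat) : (h i <= n)%N ->
    \prod_(q < p) ((skew_beta n (fun=> 0%N) (k + q))%:R - (skew_beta n h i)%:R)
      = poch (k - i + h i)%N%:R p.
  move=> le_hn; rewrite /poch big_mkord; apply: eq_bigr => q _.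
  by rewrite -natrB /skew_beta; [rewrite -natrD; congr _%:R; lia | lia].
rewrite (eq_bigr (fun q : 'I_p => (skew_beta n (fun=> 0%N) (k + q))%:R - (skew_beta n c i)%:R)); last first.
  by move=> q _; rewrite skew_beta_tail.
rewrite !prod_poch // addn0; apply/eqP; rewrite eqr_div ?poch_nat_neq0 //; try lia.
have -> : (k + p - i = k - i + p)%N by lia.
by rewrite mulrC [X in _ == X]mulrC !natrD -!pochD addnC.
Qed.

(** Expanding (k-i)_(c_i) as c_i! times the factors (c_i + j - i) / (j - i) for
i < j < k distributes the denominator over the pairs i < j. *)
Lemma weyl_dim_poch k c :
  weyl_dim k c / \prod_(i < k) poch (k - i)%N%:R (c i)
    = \prod_(j < k) ((c j)`!%:R^-1 * \prod_(i < j)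
        (((c i)%:R - (c j)%:R + (j%:R - i%:R)) / ((c i)%:R + (j%:R - i%:R)))).
Proof.
have split_poch (i : 'I_k) : poch (k - i)%N%:R (c i)
    = (c i)`!%:R * \prod_(j < k | (i < j)%N) (((c i)%:R + (j%:R - i%:R)) / (j%:R - i%:R)).
  have lt_ik := ltn_ord i.
  pose f (j : nat) : rat := ((c i)%:R + (j%:R - i%:R)) / (j%:R - i%:R).
  suff tele q : (i + q < k)%N ->
      poch q.+1%:R (c i) = (c i)`!%:R * \prod_(j < (i + q).+1 | (i < j)%N) f j.
    have ek : (k - i = (k - i).-1.+1)%N by lia.
    rewrite ek tele; last by lia.
    by rewrite -[in RHS](big_mkord (fun j => i < j)%N f) -(big_mkord (fun j => i < j)%N f);
       congr (_ * \big[_/_]_(_ <= _ < _ | _) _); lia.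
  elim: q => [|q IH] lt_qk.
    rewrite addn0 big1 ?mulr1 ?poch1 // => j.
    by have := ltn_ord j; lia.
  rewrite addnS big_mkcond big_ord_recr /= -big_mkcond /= mulrA.
  have -> : (i < (i + q).+1)%N by lia.
  rewrite -IH ?/f; last by lia.
  have := pochD q.+1%:R 1 (c i); rewrite addnC pochD !poch_once.
  have q1_neq0 : q.+1%:R != 0 :> rat by rewrite pnatr_eq0.
  rewrite -mulrSr => e.
  apply: (mulfI q1_neq0); rewrite -e.
  have -> : (i + q).+1%:R - i%:R = q.+1%:R :> rat by rewrite -addnS natrD addrAC subrr add0r.
  by rewrite mulrCA [X in _ = _ * X]mulrC divfK // addrC.
rewrite (eq_bigr _ (fun i _ => split_poch i)) big_split /= invfM big_split /=.
rewrite mulrCA -prodfV; congr (_ * _).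
rewrite (exchange_big_dep predT) //= -prodfV -big_split /=; apply: eq_bigr => j _.
have lt_jk := ltn_ord j.
rewrite -(big_ord_widen k (fun i => ((c i)%:R + (j%:R - i%:R)) / (j%:R - i%:R))) 1?ltnW //.
rewrite -prodf_div; apply: eq_bigr => i _.
have ne : j%:R - i%:R != 0 :> rat by rewrite subr_eq0 eqr_nat gtn_eqF.
by rewrite invf_div mulrA divfK.
Qed.

Definition weight_factor (m n : nat) (c : nat -> nat) (j : nat) : rat :=
  poch (m%:R - j%:R) (c j) * poch (- (n%:R + j%:R)) (c j) / (c j)`!%:R ^+ 2
  * \prod_(i < j)
      (((c i)%:R - (c j)%:R + (j%:R - i%:R)) / ((c i)%:R + (j%:R - i%:R))) ^+ 2.

Definition weight (m n k a : nat) (c : nat -> nat) : rat :=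
  poch a%:R (\sum_(j < k) c j) / poch (- (m * n)%:R) (\sum_(j < k) c j)
  * \prod_(j < k) weight_factor m n c j.

Lemma interleavings_poch k c b :
  interleavings k c b = poch b.+1%:R (\sum_(j < k) c j)
               * (hook_ratio k (straight_beta k c) / hook_ratio k (straight_beta k (fun=> 0%N))).
Proof. by rewrite /interleavings addnC poch_fact [_ * poch _ _]mulrC mulfK ?natr_fact_neq0. Qed.

(** The signs (-1)^s of (-mn)_s and of the (-n-j)_(c_j) cancel. *)
Lemma interleavings_weight k m n c b : (k <= m)%N ->
  nonincr c -> (forall j, c j <= n)%N -> (forall j, k <= j -> c j = 0)%N ->
  interleavings k c b * (num_syt (skew m n c))%:R
    = (num_syt (skew m n (fun=> 0%N)))%:R * weight m n k b.+1 c.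
Proof.
move=> le_km nic le_cn c0; set s := (\sum_(j < k) c j)%N.
have Fm_neq0 : hook_ratio m id != 0 by apply: hook_ratio_neq0 => i j; lia.
have F0_neq0 : hook_ratio m (skew_beta n (fun=> 0%N)) != 0.
  by apply: hook_ratio_neq0 => i j; rewrite /skew_beta; lia.
apply: (mulIf Fm_neq0); rewrite -mulrA num_syt_skew //.
rewrite [RHS]mulrAC num_syt_skew //.
have sum_m : (\sum_(j < m) c j = s)%N.
  rewrite -(subnKC le_km) big_split_ord /= [X in (_ + X)%N]big1 ?addn0 // => j _.
  by rewrite c0 ?leq_addr.
have size0 : skew_size m n (fun=> 0%N) = (m * n)%N.
  by rewrite /skew_size sum_nat_const card_ord subn0.
have size_c : (skew_size m n c + s = m * n)%N.
  rewrite -sum_m -big_split /= -size0; apply: eq_bigr => j _.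
  by rewrite subnK // subn0.
have le_s : (s <= m * n)%N by rewrite -size_c leq_addl.
have fact_mn : (m * n)`!%:R = (-1) ^+ s * poch (- (m * n)%:R) s * (skew_size m n c)`!%:R.
  by rewrite (poch_opp le_s) -size_c addnK.
have := hook_ratio_skew_extend (m - k) le_cn c0.
rewrite (subnKC le_km) [X in _ = X * _]hook_ratio_skew // => ratio_m.
rewrite -[hook_ratio m (skew_beta n c)](divfK F0_neq0) ratio_m size0 fact_mn.
rewrite interleavings_poch hook_ratio_straight.
rewrite prodf_div -/s /weight -/s.
have -> : \prod_(j < k) weight_factor m n c j
   = (\prod_(j < k) poch (m - j)%N%:R (c j)) * (\prod_(j < k) poch (- (n%:R + j%:R)) (c j))
     * (weyl_dim k c / \prod_(i < k) poch (k - i)%N%:R (c i)) ^+ 2.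
  rewrite weyl_dim_poch expr2 -!big_split /=; apply: eq_bigr => j _.
  have lt_jm : (j <= m)%N by have := ltn_ord j; lia.
  by rewrite /weight_factor natrB // prodrXl expr2 invfM; ring.
have p_neq0 := poch_opp_neq0 le_s.
have q_neq0 : \prod_(i < k) poch (k - i)%N%:R (c i) != 0.
  by apply/prodf_neq0 => i _; apply: poch_nat_neq0; rewrite subn_gt0.
set P := poch _ _ in p_neq0 *.
set Q := \prod_(i < k) poch (k - i)%N%:R (c i) in q_neq0 *.
by field; rewrite p_neq0 q_neq0.
Qed.

(** * The hypergeometric rows *)

Fixpoint row_prod (rows : seq hyp_row) (ms l : seq nat) : rat :=
  match rows, l with
  | R :: rows', s :: l' => hyp_term R ms s * row_prod rows' (rcons ms s) l'
  | _, _ => 1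
  end.

Lemma mhyp_from_parts rows ms p :
  mhyp_from rows ms p = \sum_(l <- parts (size rows) p) row_prod rows ms l.
Proof.
elim: rows ms p => [|R rows IH] ms p; first by rewrite /= big_seq1.
rewrite -[parts _ _]/(flatten [seq [seq s :: l | l <- parts (size rows) s] | s <- iota 0 p.+1]).
rewrite big_flatten big_map /=; apply: eq_bigr => s _.
by rewrite big_map IH mulr_sumr.
Qed.

(** The squared parameters pair up as -x over -x-1 with x = c_i + j - i - 1.
S stands for the sum of the preceding indices. *)
Lemma hyp_term_weight m n a S c j R ms xs : nonincr c ->
  xs = [seq (c i + (j - i).-1)%N | i <- iota 0 j] ->
  hyp_arg R = 1 ->
  hyp_upper R ms = [:: a%:R + S%:R, m%:R - j%:R, - (n%:R + j%:R)
                     & flatten [seq [:: - x%:R; - x%:R] | x <- xs]] ->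
  hyp_lower R ms = - (m * n)%:R + S%:R ::
    rcons (flatten [seq [:: - x%:R - 1; - x%:R - 1] | x <- xs]) 1 ->
  hyp_term R ms (c j) =
    poch (a%:R + S%:R) (c j) / poch (- (m * n)%:R + S%:R) (c j) * weight_factor m n c j.
Proof.
move=> nic exs z1 eU eL; rewrite /hyp_term z1 expr1n eU eL.
rewrite !big_cons -cats1 big_cat big_seq1 poch1 !big_flatten !big_map /=.
rewrite /weight_factor.
have -> : \prod_(i < j) (((c i)%:R - (c j)%:R + (j%:R - i%:R)) / ((c i)%:R + (j%:R - i%:R))) ^+ 2
   = (\prod_(x <- xs) \prod_(y <- [:: - x%:R; - x%:R]) poch y (c j))
     / \prod_(x <- xs) \prod_(y <- [:: - x%:R - 1; - x%:R - 1]) poch y (c j) :> rat.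
  rewrite -prodf_div exs big_map -[X in iota 0 X]subn0 big_mkord.
  apply: eq_bigr => i _; have lt_ij := ltn_ord i; have := nic i j (ltnW lt_ij) => le_cji.
  rewrite !big_cons !big_nil !mulr1 -mulf_div poch_opp_ratio -?expr2; last by lia.
  have -> : (c i + (j - i).-1).+1 = (c i + (j - i))%N by lia.
  by rewrite natrD natrB 1?ltnW //; congr ((_ / _) ^+ 2); ring.
by rewrite !invfM; ring.
Qed.

Lemma poch_ratioD x y S c :
  poch x (S + c) / poch y (S + c)
    = poch x S / poch y S * (poch (x + S%:R) c / poch (y + S%:R) c).
Proof. by rewrite !pochD mulf_div. Qed.

Ltac list_ring :=
  rewrite /=; repeat match goal with |- _ :: _ = _ :: _ => apply: (congr2 cons); [ring |] end;
  reflexivity.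

(** The parameters a + S and -mn + S of consecutive rows telescope to a single
Pochhammer symbol of length s. *)
Lemma battery6_weight m n a (l : seq nat) : l \in parts 5 n ->
  row_prod (battery6_rows m n a) [::] l = weight m n 5 a (nth 0%N l).
Proof.
move=> /partsP[]; case: l => [|t [|v [|w [|r [|k []]]]]] // _ ni _.
pose c := nth 0%N [:: t; v; w; r; k].
have row S j xs R ms := @hyp_term_weight m n a S c j R ms xs ni.
rewrite /battery6_rows /row_prod /weight !big_ord_recr !big_ord0 /= !poch_ratioD.
(* The offsets are written so that each list is convertible to the one with
   entries c_i + (j - i).-1. *)
rewrite (row 0%N 0%N [::]) //; [|list_ring..].
rewrite (row (0 + t)%N 1%N [:: t + 0]%N) //; [|list_ring..].
rewrite (row (0 + t + v)%N 2%N [:: t + 1; v + 0]%N) //; [|list_ring..].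
rewrite (row (0 + t + v + w)%N 3%N [:: t + 2; v + 1; w + 0]%N) //; [|list_ring..].
rewrite (row (0 + t + v + w + r)%N 4%N [:: t + 3; v + 2; w + 1; r + 0]%N) //; [|list_ring..].
(* The quotient 1 / 1 below is that of the two empty Pochhammer symbols. *)
have poch_nil x : poch x 0 = 1 by rewrite /poch big_geq.
rewrite !poch_nil.
have regroup (x0 x1 x2 x3 x4 y0 y1 y2 y3 y4 : rat) :
    x0 * y0 * (x1 * y1 * (x2 * y2 * (x3 * y3 * (x4 * y4 * 1))))
    = 1 / 1 * x0 * x1 * x2 * x3 * x4 * (1 * y0 * y1 * y2 * y3 * y4) by field.
exact: regroup.
Qed.

Lemma rect_shapeE m n : rect_shape m n = skew m n (fun=> 0%N).
Proof.
apply/fsetP => c; rewrite in_fset; apply/allpairsPdep/skewP.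
  move=> [i [j [Hi Hj ->]]]; exists i.-1, j.-1; move: Hi Hj; rewrite !mem_iota.
  by move=> Hi Hj; split; [congr (_, _); lia | lia].
by move=> [i [j [-> H]]]; exists i.+1, j.+1; rewrite !mem_iota; split=> //; lia.
Qed.

Theorem theorem5p11 (m n a : nat)
    (hm : (6 <= m)%N) (hn : (0 < n)%N) (ha : (0 < a)%N) :
  (num_syt (battery_shape m n a 6))%:R =
    (num_syt (rect_shape m n))%:R * mhyp n (battery6_rows m n a) :> rat.
Proof.
have -> : battery_shape m n a 6 = chimney_on m n (fun=> 0%N) a 5.
  by rewrite /battery_shape rect_shapeE.
case: a ha => // b _; rewrite rect_shapeE.
rewrite -(chimney_transfer n hm (ltnSn b)) subnn /mhyp mhyp_from_parts mulr_sumr.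
rewrite [LHS]big_seq [RHS]big_seq; apply: eq_bigr => l l_in.
have [szl ni le_n] := partsP _ _ _ l_in.
have -> : chimney_on m n (nth 0%N l) 0 5 = skew m n (nth 0%N l).
  apply/fsetP => c; rewrite in_fsetU.
  by case: chimneyP => [[] //|_]; rewrite orbF.
rewrite battery6_weight // interleavings_weight //; first exact: ltnW.
  by move=> j; apply: leq_trans (ni 0%N j (leq0n j)) le_n.
by move=> j le_kj; rewrite nth_default ?szl.
Qed.
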